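(* Let $X$ be a $T_1$ topological space. Then: (1) for every integer $n\ge 1$, the canonical injection $\sigma_n:X^{\otimes n}\to F_q(X)$, $\sigma_n(x_1,x_2,\dots,x_n)=x_1x_2\cdots x_n$, is a closed embedding (a homeomorphism onto its image, with closed image); (2) $F_q(X)$ has the weak topology with respect to the subspaces $\{F_q(X)_n\}_{n\ge 0}$, i.e. a subset $C\subseteq F_q(X)$ is closed if and only if $C\cap F_q(X)_n$ is closed in $F_q(X)_n$ for all $n\ge 0$; (3) for every integer $n\ge 0$, the canonical map $\mathbf{i}_n:\coprod_{i=0}^{n}(X\sqcup X^{-1})^{\otimes i}\to F_q(X)_n$ is a topological quotient map, where $F_q(X)_n$ has the subspace topology inherited from $F_q(X)$.
   Context: Cross product: for topological spaces $X_1,X_2$, $X_1\otimes X_2$ is the set $X_1\times X_2$ with the topology in which $U$ is open iff $\{x\in X_1 : (x,y)\in U\}$ is open in $X_1$ for every $y\in X_2$ and $\{y\in X_2:(x,y)\in U\}$ is open in $X_2$ for every $x\in X_1$. $X^{\otimes n}$ is the $n$-fold iterated cross product of $X$ with itself (equivalently, $X^n$ with a set open iff each of its slices obtained by fixing all but one coordinate is open in $X$); $X^{\otimes 0}=\{e\}$ is a one-point space. For a space $Z$, $M_{st}(Z)=\coprod_{n\ge 0}Z^{\otimes n}$ (topological sum); its elements are written as words $z_1z_2\cdots z_n$, and it is a monoid under concatenation with identity the empty word $e$. For a space $X$, $X^{-1}$ is a homeomorphic copy of $X$ with elements written $x^{-1}$, and $X\sqcup X^{-1}$ is the topological sum. $F(X)$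 is the free group on the set $X$, realized as the set of reduced words in $X\sqcup X^{-1}$, and $R:M_{st}(X\sqcup X^{-1})\to F(X)$ sends each word to its reduced form. The free quasitopological group $F_q(X)$ is $F(X)$ with the quotient topology induced by $R$. $F_q(X)_n$ is the subspace of $F_q(X)$ of reduced words of length at most $n$. The map $\mathbf{i}_n$ is the restriction of $R$ to $\coprod_{i=0}^{n}(X\sqcup X^{-1})^{\otimes i}$. *)

(* Defs.v *)
From HB Require Import structures.
From mathcomp Require Import all_boot monoid.
From mathcomp Require Import generic_quotient.
From mathcomp Require Import boolp classical_sets functions.
From mathcomp Require Import topology.

Set Implicit Arguments.
Unset Strict Implicit.
Unset Printing Implicit Defensive.

Local Open Scope classical_set_scope.

Definition cross (X Y : Type) : Type := (X * Y)%type.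

Section Cross.
Variables X Y : topologicalType.

Definition cross_open : set (set (cross X Y)) :=
  [set U | (forall y, open [set x | U (x, y)]) /\
           (forall x, open [set y | U (x, y)])].

Local Lemma cross_openT : cross_open setT.
Proof. by split=> ?; exact: openT. Qed.

Local Lemma cross_openI : setI_closed cross_open.
Proof.
by move=> A B [A1 A2] [B1 B2]; split=> z;
  [exact: (openI (A1 z) (B1 z)) | exact: (openI (A2 z) (B2 z))].
Qed.

Local Lemma cross_open_bigU (I : Type) (f : I -> set (cross X Y)) :
  (forall i, cross_open (f i)) -> cross_open (\bigcup_i f i).
Proof.
move=> fo; split=> z.
  rewrite (_ : mkset _ = \bigcup_i [set x | f i (x, z)]); last by [].
  by apply: bigcup_open => i _; exact: (fo i).1.
rewrite (_ : mkset _ = \bigcup_i [set y | f i (z, y)]); last by [].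
by apply: bigcup_open => i _; exact: (fo i).2.
Qed.

HB.instance Definition _ := Choice.copy (cross X Y) (X * Y)%type.
HB.instance Definition _ :=
  isOpenTopological.Build (cross X Y) cross_openT cross_openI cross_open_bigU.

Lemma cross_openE (U : set (cross X Y)) :
  open U <-> (forall y, open [set x | U (x, y)]) /\
             (forall x, open [set y | U (x, y)]).
Proof. by []. Qed.

End Cross.

Definition cross_power (Z : Type) (n : nat) : Type := n.-tuple Z.

Definition tuple_set (Z : Type) n (t : n.-tuple Z) (i : 'I_n) (z : Z) :
    n.-tuple Z :=
  [tuple if j == i then z else tnth t j | j < n].

HB.instance Definition _ (Z : choiceType) n :=
  Choice.copy (cross_power Z n) (n.-tuple Z).

Section CrossPower.
Variables (Z : topologicalType) (n : nat).

(* U is open iff all its slices, obtained by fixing all coordinates but one,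
   are open. *)
Definition cross_power_open : set (set (cross_power Z n)) :=
  [set U | forall (t : n.-tuple Z) (i : 'I_n),
     open [set z | U (tuple_set t i z)]].

Local Lemma cross_power_openT : cross_power_open setT.
Proof. by move=> t i; exact: openT. Qed.

Local Lemma cross_power_openI : setI_closed cross_power_open.
Proof. by move=> A B oA oB t i; exact: (openI (oA t i) (oB t i)). Qed.

Local Lemma cross_power_open_bigU (I : Type) (f : I -> set (cross_power Z n)) :
  (forall i, cross_power_open (f i)) -> cross_power_open (\bigcup_i f i).
Proof.
move=> fo t k.
rewrite (_ : mkset _ = \bigcup_i [set z | f i (tuple_set t k z)]); last by [].
by apply: bigcup_open => i _; exact: fo.
Qed.

HB.instance Definition _ := isOpenTopological.Build (cross_power Z n)
  cross_power_openT cross_power_openI cross_power_open_bigU.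

Lemma cross_power_openE (U : set (cross_power Z n)) :
  open U <-> forall (t : n.-tuple Z) (i : 'I_n),
               open [set z | U (tuple_set t i z)].
Proof. by []. Qed.

End CrossPower.

(* By the next two lemmas, cross_power is the iterated binary cross product,
   starting from a one-point space. *)
Lemma cross_power0 (Z : Type) (t : cross_power Z 0) : t = [tuple].
Proof. exact: tuple0. Qed.

Lemma cross_powerS (Z : topologicalType) n (U : set (cross_power Z n.+1)) :
  open U <->
  open ((fun p => cons_tuple p.1 p.2) @^-1` U : set (cross Z (cross_power Z n))).
Proof.
have set0E z0 (t : n.-tuple Z) z :
    tuple_set (cons_tuple z0 t) ord0 z = cons_tuple z t.
  apply: eq_from_tnth => j; rewrite tnth_mktuple.
  by case: (unliftP ord0 j) => [k|] ->; rewrite ?eqxx ?tnth0 // !tnthS.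
have setSE z0 (t : n.-tuple Z) i z :
    tuple_set (cons_tuple z0 t) (lift ord0 i) z = cons_tuple z0 (tuple_set t i z).
  apply: eq_from_tnth => j; rewrite tnth_mktuple.
  case: (unliftP ord0 j) => [k|] ->; rewrite ?tnth0 // !tnthS tnth_mktuple.
  by rewrite (inj_eq (@lift_inj _ ord0)).
split=> [/cross_power_openE oU | /cross_openE[oU1 oU2]].
  apply/cross_openE; split=> [t | z0]; last first.
    apply/cross_power_openE => t i /=.
    have := oU (cons_tuple z0 t) (lift ord0 i).
    under [X in open X -> _]eq_set do rewrite setSE.
    exact.
  have [[z0 Uz0]|U0] := pselect (exists z0, U (cons_tuple z0 t)).
    have := oU (cons_tuple z0 t) ord0.
    under [X in open X -> _]eq_set do rewrite set0E.
    exact.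
  rewrite (_ : mkset _ = set0); first exact: open0.
  by apply/seteqP; split=> // z Uz; apply: U0; exists z.
apply/cross_power_openE => t i; case/tupleP: t => z0 t.
case: (unliftP ord0 i) => [k|] ->.
  under eq_set do rewrite setSE.
  by move/cross_power_openE: (oU2 z0); apply.
under eq_set do rewrite set0E.
exact: oU1.
Qed.

Definition Mst (Z : Type) : Type := {n : nat & cross_power Z n}.

HB.instance Definition _ (Z : choiceType) :=
  Choice.copy (Mst Z) {n : nat & cross_power Z n}.
HB.instance Definition _ (Z : topologicalType) :=
  Topological.copy (Mst Z) {n : nat & cross_power Z n}.

Definition seq_of_Mst (Z : Type) (w : Mst Z) : seq Z := tval (projT2 w).

Definition Mst_of_seq (Z : Type) (s : seq Z) : Mst Z :=
  existT (cross_power Z) (size s) (in_tuple s).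

Lemma Mst_of_seqK (Z : Type) : cancel (@Mst_of_seq Z) (@seq_of_Mst Z).
Proof. by []. Qed.

Lemma seq_of_MstK (Z : Type) : cancel (@seq_of_Mst Z) (@Mst_of_seq Z).
Proof.
case=> n [s sn]; rewrite /seq_of_Mst /Mst_of_seq /=.
move: (sn); rewrite -(eqP sn) => sn'.
by congr existT; apply: val_inj.
Qed.

(* [existT _ true x] is the letter x, [existT _ false x] the letter x^-1. *)
Definition letter (X : Type) : Type := {b : bool & X}.

HB.instance Definition _ (X : choiceType) :=
  Choice.copy (letter X) {b : bool & X}.
HB.instance Definition _ (X : topologicalType) :=
  Topological.copy (letter X) {b : bool & X}.

Definition pos_letter (X : Type) (x : X) : letter X :=
  existT (fun=> X) true x.

Definition inv_letter (X : Type) (a : letter X) : letter X :=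
  existT (fun=> X) (~~ projT1 a) (projT2 a).

Lemma inv_letterK (X : Type) : involutive (@inv_letter X).
Proof. by case=> [[] x]. Qed.

Section FreeGroup.
Variable X : choiceType.
Implicit Types (a b : letter X) (u v w : seq (letter X)).

Definition reduced w : bool := sorted (fun a b => a != inv_letter b) w.

(* On a reduced word w, this is the reduced form of a followed by w. *)
Definition reduce_cons a w : seq (letter X) :=
  if w is b :: w' then if a == inv_letter b then w' else a :: w else [:: a].

Definition reduce w : seq (letter X) := foldr reduce_cons [::] w.

Lemma reduce_reduced w : reduced (reduce w).
Proof.
elim: w => //= a w; case: (reduce w) => //= b u bu.
case: eqVneq => [_|ab]; first exact: path_sorted bu.
by rewrite /reduced /= ab.
Qed.

Lemma reduced_reduce w : reduced w -> reduce w = w.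
Proof.
elim: w => //= a w IHw aw; rewrite IHw; last exact: path_sorted aw.
by case: w aw {IHw} => //= b w /andP[/negPf ->].
Qed.

Lemma reduce_consK a w : reduced w ->
  reduce_cons a (reduce_cons (inv_letter a) w) = w.
Proof.
case: w => [|b w] bw /=; first by rewrite inv_letterK eqxx.
rewrite (inj_eq (can_inj (@inv_letterK X))).
case: (eqVneq a b) => [ab|_]; last by rewrite /= inv_letterK eqxx.
by subst b; case: w bw => //= c w /andP[/negPf ->].
Qed.

Lemma reduce_catr u v : reduce (u ++ reduce v) = reduce (u ++ v).
Proof.
by rewrite /reduce !foldr_cat; congr foldr; exact/reduced_reduce/reduce_reduced.
Qed.

Lemma reduce_cancel u v a :
  reduce (u ++ a :: inv_letter a :: v) = reduce (u ++ v).
Proof.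
rewrite /reduce !foldr_cat /= reduce_consK //; exact: reduce_reduced.
Qed.

Lemma reduce_catl u v : reduce (reduce u ++ v) = reduce (u ++ v).
Proof.
elim: u => //= a u <-; case: (reduce u) => //= b w.
by case: eqVneq => //= ->; rewrite -{2}[b]inv_letterK reduce_consK
  //; exact: reduce_reduced.
Qed.

Definition free_group : Type := {w : seq (letter X) | reduced w}.

HB.instance Definition _ :=
  Choice.copy free_group {w : seq (letter X) | reduced w}.

Definition fg_word (g : free_group) : seq (letter X) := sval g.

Lemma fg_word_inj : injective fg_word.
Proof. exact: val_inj. Qed.

Definition fg_of_seq w : free_group := exist _ (reduce w) (reduce_reduced w).

Definition fg1 : free_group := fg_of_seq [::].
Definition fg_inv (g : free_group) : free_group :=
  fg_of_seq (rev (map (@inv_letter X) (fg_word g))).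
Definition fg_mul (g h : free_group) : free_group :=
  fg_of_seq (fg_word g ++ fg_word h).

Lemma fg_wordK : cancel fg_word fg_of_seq.
Proof. by move=> [w rw]; apply: fg_word_inj; exact: reduced_reduce. Qed.

Local Lemma fg_mulA : associative fg_mul.
Proof.
by move=> f g h; apply: fg_word_inj; rewrite /= reduce_catl reduce_catr catA.
Qed.

Local Lemma fg_mul1g : left_id fg1 fg_mul.
Proof. by move=> g; rewrite /fg_mul fg_wordK. Qed.

Local Lemma fg_mulg1 : right_id fg1 fg_mul.
Proof. by move=> g; rewrite /fg_mul cats0 fg_wordK. Qed.

Local Lemma fg_mulgV : right_inverse fg1 fg_inv fg_mul.
Proof.
move=> g; apply: fg_word_inj; rewrite /= reduce_catr.
elim: (fg_word g) => // a w IHw.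
rewrite /= rev_cons -cats1 catA -reduce_catl IHw /=.
by rewrite inv_letterK eqxx.
Qed.

Local Lemma fg_mulVg : left_inverse fg1 fg_inv fg_mul.
Proof.
move=> g; apply: fg_word_inj; rewrite /= reduce_catl.
elim: (fg_word g) => // a w IHw.
rewrite /= rev_cons -cats1 -catA /= -[X in reduce (_ ++ _ :: X :: _)]inv_letterK.
by rewrite reduce_cancel.
Qed.

HB.instance Definition _ := isGroup.Build free_group
  fg_mulA fg_mul1g fg_mulg1 fg_mulVg fg_mulgV.

Definition fg_reduce (w : Mst (letter X)) : free_group :=
  fg_of_seq (seq_of_Mst w).

Local Lemma fg_reprK : cancel (fun g => Mst_of_seq (fg_word g)) fg_reduce.
Proof. exact: fg_wordK. Qed.

(* The quotient map of this instance is R = fg_reduce, so quotient_topology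
   below is the quotient topology induced by R. *)
HB.instance Definition _ :=
  isQuotient.Build (Mst (letter X)) free_group fg_reprK.

End FreeGroup.

Definition Fq (X : topologicalType) : topologicalType :=
  @quotient_topology (Mst (letter X)) (free_group X).

Lemma open_FqE (X : topologicalType) (U : set (Fq X)) :
  open U <-> open (@fg_reduce X @^-1` U).
Proof.
rewrite {1}/open /= /quotient_open (_ : \pi%qT = @fg_reduce X :> (_ -> Fq X)) //.
by rewrite unlock.
Qed.

Definition Fq_le (X : topologicalType) (n : nat) : set (Fq X) :=
  [set g | size (fg_word (g : free_group X)) <= n].

Lemma reduced_pos (X : choiceType) (s : seq X) :
  reduced (map (@pos_letter X) s).
Proof. by elim: s => //= x [|y s] //=. Qed.

Definition sigma (X : topologicalType) (n : nat) (t : cross_power X n) : Fq X :=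
  exist _ (map (@pos_letter X) (tval t)) (reduced_pos (tval t)) : free_group X.

Lemma size_reduce (X : choiceType) (w : seq (letter X)) :
  size (reduce w) <= size w.
Proof.
elim: w => //= a w; case: (reduce w) => //= b u ub.
by case: ifP => _ //=; exact: leqW (ltnW ub).
Qed.

Definition Mst_le (Z : Type) (n : nat) : Type :=
  {i : 'I_n.+1 & cross_power Z i}.

HB.instance Definition _ (Z : topologicalType) n :=
  Topological.copy (Mst_le Z n) {i : 'I_n.+1 & cross_power Z i}.

Definition Mst_of_le (Z : Type) (n : nat) (w : Mst_le Z n) : Mst Z :=
  existT (cross_power Z) (projT1 w) (projT2 w).

Lemma fg_reduce_le (X : topologicalType) n (w : Mst_le (letter X) n) :
  Fq_le n (fg_reduce (Mst_of_le w) : Fq X).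
Proof.
apply: leq_trans (size_reduce _) _; rewrite size_tuple.
by rewrite -ltnS ltn_ord.
Qed.

Definition i_map (X : topologicalType) (n : nat) (w : Mst_le (letter X) n) :
    (Fq_le n : set (Fq X)) :=
  exist _ (fg_reduce (Mst_of_le w) : Fq X) (mem_set (fg_reduce_le w)).

(* Below, a set A used as a type is set_type A, which carries the subspace
   topology. *)

Definition homeomorphism (S T : topologicalType) (f : S -> T) : Prop :=
  exists g : T -> S,
    [/\ cancel f g, cancel g f, continuous f & continuous g].

Definition to_range (S T : Type) (f : S -> T) (x : S) : range f :=
  exist _ (f x) (mem_set (imageT f x)).

Definition closed_embedding (S T : topologicalType) (f : S -> T) : Prop :=
  homeomorphism (to_range f) /\ closed (range f).

Definition quotient_map (S T : topologicalType) (f : S -> T) : Prop :=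
  (forall y, exists x, f x = y) /\
  (forall U : set T, open U <-> open (f @^-1` U)).

Definition weak_topology_wrt (T : topologicalType) (F : nat -> set T) : Prop :=
  forall C : set T,
    closed C <-> forall n, closed (set_val @^-1` C : set (F n)).

(* Main.v *)
Require Import Defs.
From mathcomp Require Import all_boot.
From mathcomp Require Import boolp classical_sets functions topology.
From mathcomp Require Import cardinality.

(** Since [Fq X] is a quotient of the space of words and words carry the
    topology of separate continuity, a set [C] of group elements is closed
    exactly when every slice [{z | R (u z v) in C}], for fixed words [u] and
    [v], is closed ([closed_FqP]).

    Everything rests on one observation, [closed_Fq_leP]: if all elements of
    [C] have length at most [n], only the slices by [u] and [v] with
    [|u| + |v| < n] need to be checked.  Suppose that [|u| + |v| >= n].  If [u]
    or [v] is not reduced, reducing it does not change the slice, and induction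
    on the length applies.  If both are reduced, the word [u z v] is longer than
    every element of [C], so [z] can only be in the slice when [u z v] is not
    reduced, that is, when [z] cancels against a neighbouring letter.  So the
    slice is finite, and a finite set of letters is closed because [X] is T1.

    In particular [Fq_le n] is closed, and since a set of elements of length at
    most [n] is closed as soon as its preimage in the words of length at most
    [n] is, [i_map n] is a quotient map.  The weak topology holds since the
    slice of [C] by [u] and [v] only involves elements of [C] of length at most
    [|u| + |v| + 1].  Finally [sigma n] is a closed map: a word of length at most
    [n] whose reduced form is a positive word of length [n] is that positive
    word, so the slices to be checked for the image of a closed set [A] are
    empty or copies of slices of [A]. *)

Set Implicit Arguments.
Unset Strict Implicit.
Unset Printing Implicit Defensive.

Local Open Scope classical_set_scope.

(** * Closed sets in the ambient topologies *)

Lemma closed_sigTP (I : choiceType) (T : I -> topologicalType)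
    (C : set {i & T i}) :
  closed C <-> forall i, closed (existT T i @^-1` C).
Proof.
rewrite -openC; split=> [/sigT_openP oC i | cC].
  by rewrite -openC; exact: oC.
by apply/sigT_openP => i; have := cC i; rewrite -openC.
Qed.

Lemma closed_set_typeP (T : topologicalType) (A : set T) (C : set A) :
  closed C <-> exists2 D : set T, closed D & C = set_val @^-1` D.
Proof.
rewrite -openC; split=> [[D oD DC] | [D cD ->]].
  by exists (~` D); [exact: open_closedC | rewrite -preimage_setC DC setCK].
by exists (~` D); [exact: closed_openC | ].
Qed.

Lemma closed_image_set_val (T : topologicalType) (A : set T) (C : set A) :
  closed A -> closed C <-> closed (set_val @` C : set T).
Proof.
move=> cA; split=> [/closed_set_typeP[D cD ->] | cC].
  rewrite (_ : _ @` _ = D `&` A); first exact: closedI.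
  apply/seteqP; split=> [_ [x Dx <-]|x [Dx Ax]].
    by split=> //; exact: set_mem (valP x).
  by exists (exist _ x (mem_set Ax)).
apply/closed_set_typeP; exists (set_val @` C) => //.
apply/seteqP; split=> [x Cx|x [y Cy yx]]; first by exists x.
by rewrite -(val_inj yx).
Qed.

(** The inverse of [to_range f] is continuous because the preimage under it of
    a closed set [A] is the trace on [range f] of the closed set [f @` A]. *)
Lemma closed_injection_embedding (S T : topologicalType) (f : S -> T) :
  injective f -> continuous f ->
  (forall A, closed A -> closed (f @` A)) -> closed_embedding f.
Proof.
move=> f_inj f_cont f_closed; split; last exact/f_closed/closedT.
have f_surj (y : range f) : {x | f x = val y}.
  by apply: cid; have [x _ fx] := set_mem (valP y); exists x.
exists (fun y => sval (f_surj y)); split.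
- by move=> x; apply: f_inj; rewrite (svalP (f_surj _)).
- by move=> y; apply: val_inj; rewrite /= (svalP (f_surj _)).
- apply/continuous_closedP => _ /closed_set_typeP[D cD ->].
  by move/continuous_closedP: f_cont => /(_ _ cD).
apply/continuous_closedP => A cA; apply/closed_set_typeP.
exists (f @` A); first exact: f_closed.
apply/seteqP; split=> [y Ay|y [x Ax fxy]].
  by exists (sval (f_surj y)) => //; exact: (svalP (f_surj y)).
by rewrite /= (_ : sval _ = x) //; apply: f_inj; rewrite (svalP (f_surj y)).
Qed.

Lemma tuple_setE (Z : Type) n (t : n.-tuple Z) (i : 'I_n) z :
  tval (tuple_set t i z) = take i t ++ z :: drop i.+1 t.
Proof.
have it : i < size t by rewrite size_tuple.
apply: (@eq_from_nth _ z) => [|k].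
  rewrite size_tuple size_cat /= size_takel ?(ltnW it) // size_drop.
  by rewrite addnS -addSn subnKC ?size_tuple.
rewrite size_tuple => kn; rewrite -(tnth_nth z _ (Ordinal kn)) tnth_mktuple.
rewrite (tnth_nth z) /= -val_eqE /=.
rewrite nth_cat size_takel ?(ltnW it) //.
case: (ltngtP k i) => [ki|ik|->]; last by rewrite subnn.
  by rewrite nth_take.
by rewrite -[k in RHS](subnKC ik) addSn -addnS addKn /= nth_drop subnKC.
Qed.

(** Closedness in a cross power in terms of plain sequences, which makes it
    possible to compare words of different lengths. *)
Lemma closed_cross_powerP (Z : topologicalType) n (A : set (seq Z)) :
  closed ([set t | A (tval t)] : set (cross_power Z n)) <->
  forall u v, (size u + size v).+1 = n -> closed [set z | A (u ++ z :: v)].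
Proof.
rewrite -openC cross_power_openE; split=> [oA u v uvn | cA t i].
  have [[z0 _]|noz] := pselect (exists z0, A (u ++ z0 :: v)); last first.
    rewrite (_ : mkset _ = set0); first exact: closed0.
    by apply/seteqP; split=> // z Az; apply: noz; exists z.
  have uv_size : size (u ++ z0 :: v) == n by rewrite size_cat addnS uvn.
  have un : size u < n by rewrite -uvn ltnS leq_addr.
  have := oA (Tuple uv_size) (Ordinal un).
  rewrite -openC (_ : mkset _ = ~` [set z | A (u ++ z :: v)]) //.
  apply/seteqP; split=> z /=;
    by rewrite tuple_setE /= take_size_cat // drop_cat ltnNge leqnSn /=
      subSnn /= drop0.
have itn : i < size t by rewrite size_tuple.
rewrite (_ : mkset _ = ~` [set z | A (take i t ++ z :: drop i.+1 t)]).
  apply/closed_openC/cA; rewrite size_takel ?(ltnW itn) // size_drop.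
  by rewrite -addSn subnKC ?size_tuple.
by apply/seteqP; split=> z /=; rewrite tuple_setE.
Qed.

(** * The slice criterion *)

Definition letter_base (X : Type) (a : letter X) : X := projT2 a.

Lemma closed_letters (X : topologicalType) (s : seq (letter X))
    (B : set (letter X)) :
  accessible_space X -> B `<=` [set` s] -> closed B.
Proof.
move=> X_T1 Bs; apply/closed_sigTP => b.
apply: (accessible_finite_set_closed.1 X_T1).
apply: (@sub_finite_set X _ [set` map (@letter_base X) s]) => // x Bx.
by apply/mapP; exists (existT _ b x) => //; exact: Bs.
Qed.

Lemma closed_FqP (X : topologicalType) (C : set (Fq X)) :
  closed C <-> forall u v, closed [set z | C (fg_of_seq (u ++ z :: v))].
Proof.
have -> : closed C <->
    forall n, closed ([set t | C (fg_of_seq (tval t))]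
                        : set (cross_power (letter X) n)).
  rewrite -openC open_FqE preimage_setC openC.
  exact: (@closed_sigTP nat (cross_power (letter X))).
split=> [cC u v|cC n]; first by
  have /(closed_cross_powerP _ (C \o @fg_of_seq X)) := cC (size u + size v).+1;
  exact.
by apply/(closed_cross_powerP _ (C \o @fg_of_seq X)) => u v _; exact: cC.
Qed.

Lemma size_reduce_lt (X : choiceType) (w : seq (letter X)) :
  ~~ reduced w -> size (reduce w) < size w.
Proof.
elim: w => // a w IHw; have [rw|nrw] := boolP (reduced w); last first.
  move=> _ /=; apply: leq_ltn_trans (_ : (size (reduce w)).+1 < _).
    by case: (reduce w) => //= b u; case: ifP => // _; rewrite leqW.
  by rewrite ltnS IHw.
rewrite /= (reduced_reduce rw); case: w rw {IHw} => //= b w bw.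
by rewrite /reduced /= negb_and negbK [path _ _ _]bw orbF => ->.
Qed.

Lemma reduced_insert (X : choiceType) (u v : seq (letter X)) (z : letter X) :
  reduced u -> reduced v -> z \notin map (@inv_letter X) (u ++ v) ->
  reduced (u ++ z :: v).
Proof.
move=> ru rv; rewrite map_cat mem_cat negb_or => /andP[zu zv].
rewrite /reduced sorted_cat_cons; apply/andP; split; last first.
  case: v rv zv => //= b v bv; rewrite inE negb_or => /andP[zb _].
  by rewrite zb.
case: u ru zu => //= a u au /= zau.
rewrite rcons_path [path _ _ _]au /=; apply: contraNneq zau.
by move=> uz; rewrite -[z]inv_letterK -uz (map_f _ (mem_last a u)).
Qed.

(** The slices that are not assumed closed are either finite or equal to slices
    by shorter words; hence the induction on [|u| + |v|]. *)
Lemma closed_Fq_leP (X : topologicalType) n (C : set (Fq X)) :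
  accessible_space X -> C `<=` Fq_le n ->
  closed C <->
  forall u v, size u + size v < n ->
    closed [set z | C (fg_of_seq (u ++ z :: v))].
Proof.
move=> X_T1 Cn; rewrite closed_FqP; split=> [cC u v _ //|cC u v].
have [m] := ubnP (size u + size v); elim: m u v => // m IHm u v uvm.
have [uvn|nuv] := ltnP (size u + size v) n; first exact: cC.
have [ru|/size_reduce_lt ltu] := boolP (reduced u); last first.
  rewrite (_ : mkset _ = [set z | C (fg_of_seq (reduce u ++ z :: v))]).
    by apply: IHm; rewrite -ltnS; apply: leq_trans uvm; rewrite ltnS ltn_add2r.
  apply/eq_set => z; congr (C _).
  by apply: fg_word_inj; rewrite /= reduce_catl.
have [rv|/size_reduce_lt ltv] := boolP (reduced v); last first.
  rewrite (_ : mkset _ = [set z | C (fg_of_seq (u ++ z :: reduce v))]).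
    by apply: IHm; rewrite -ltnS; apply: leq_trans uvm; rewrite ltnS ltn_add2l.
  apply/eq_set => z; congr (C _).
  by apply: fg_word_inj; rewrite /= -!cat_rcons reduce_catr.
apply: (closed_letters (s := map (@inv_letter X) (u ++ v))) => // z Cz.
apply: contraPP (Cn _ Cz) => /negP zuv.
rewrite /Fq_le /= reduced_reduce; last exact: reduced_insert.
by apply/negP; rewrite -ltnNge size_cat addnS ltnS.
Qed.

Lemma closed_Fq_le (X : topologicalType) n :
  accessible_space X -> closed (@Fq_le X n).
Proof.
move=> X_T1; apply/(closed_Fq_leP (n := n)) => // u v uvn.
rewrite (_ : mkset _ = setT); first exact: closedT.
apply/seteqP; split=> // z _; apply: leq_trans (size_reduce _) _.
by rewrite size_cat addnS.
Qed.

(** * The filtration by word length *)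

Lemma Fq_weak_topology (X : topologicalType) :
  accessible_space X -> weak_topology_wrt (@Fq_le X).
Proof.
move=> X_T1 C; split=> [cC n|cC]; first by apply/closed_set_typeP; exists C.
apply/closed_FqP => u v; set n := (size u + size v).+1.
have := cC n; rewrite closed_image_set_val; last exact: closed_Fq_le.
move/closed_FqP/(_ u v); congr closed; apply/seteqP; split=> z /=.
  by case=> g Cg <-.
move=> Cz; have zn : @Fq_le X n (fg_of_seq (u ++ z :: v)).
  by apply: leq_trans (size_reduce _) _; rewrite size_cat addnS.
by exists (exist _ (fg_of_seq (u ++ z :: v) : Fq X) (mem_set zn)).
Qed.

Lemma i_map_surj (X : topologicalType) n (y : (Fq_le n : set (Fq X))) :
  exists w, @i_map X n w = y.
Proof.
case: y => g gn; have := set_mem gn; rewrite /Fq_le /= -ltnS => g_lt.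
exists (existT (fun i : 'I_n.+1 => cross_power (letter X) i) (Ordinal g_lt)
  (in_tuple (fg_word g))).
by apply: val_inj; exact: fg_wordK.
Qed.

Lemma closed_i_mapP (X : topologicalType) n (C : set (Fq_le n : set (Fq X))) :
  accessible_space X -> closed C <-> closed (@i_map X n @^-1` C).
Proof.
move=> X_T1; set D := (set_val @` C : set (Fq X)).
rewrite closed_image_set_val; last exact: closed_Fq_le.
have Dn : D `<=` Fq_le n by move=> _ [x _ <-]; exact: set_mem (valP x).
rewrite -/D (closed_Fq_leP X_T1 Dn).
have DE (i : 'I_n.+1) : existT _ i @^-1` (@i_map X n @^-1` C) =
    ([set t | D (fg_of_seq (tval t))] : set (cross_power (letter X) i)).
  apply/seteqP; split=> t /=.
    by move=> Ct; exists (i_map (existT _ i t)).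
  by case=> y Cy yt; rewrite (_ : i_map _ = y) //; apply: val_inj.
have -> : closed (@i_map X n @^-1` C) <->
    forall i : 'I_n.+1, closed ([set t | D (fg_of_seq (tval t))]
                                  : set (cross_power (letter X) i)).
  apply: iff_trans
    (@closed_sigTP 'I_n.+1 (fun i => cross_power (letter X) i) _) _.
  by split=> cC i; have := cC i; rewrite DE.
split=> [cD i|cD u v uvn].
  apply/(closed_cross_powerP _ (D \o @fg_of_seq X)) => u v uvi; apply: cD.
  by rewrite uvi -ltnS.
have uvn1 : (size u + size v).+1 < n.+1 by [].
have /(closed_cross_powerP _ (D \o @fg_of_seq X)) := cD (Ordinal uvn1).
exact.
Qed.

Lemma i_map_quotient (X : topologicalType) n :
  accessible_space X -> quotient_map (@i_map X n).
Proof.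
move=> X_T1; split=> [|U]; first exact: i_map_surj.
by rewrite -closedC (closed_i_mapP _ X_T1) -preimage_setC closedC.
Qed.

(** * The embedding of positive words *)

Lemma pos_letter_inj (X : Type) : injective (@pos_letter X).
Proof. by move=> x y []. Qed.

Lemma sigma_inj (X : topologicalType) n : injective (@sigma X n).
Proof.
move=> s t /(congr1 (@fg_word X)) /= st.
by apply: val_inj; exact: (inj_map (@pos_letter_inj X)).
Qed.

Lemma sigmaE (X : topologicalType) n (t : cross_power X n) :
  sigma t = fg_of_seq (map (@pos_letter X) (tval t)).
Proof. by rewrite -[LHS]fg_wordK. Qed.

Lemma sigma_continuous (X : topologicalType) n : continuous (@sigma X n).
Proof.
apply/continuous_closedP => D /closed_FqP cD.
have -> : @sigma X n @^-1` D =
    [set t | [set s | D (fg_of_seq (map (@pos_letter X) s))] (tval t)].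
  by apply/seteqP; split=> t /=; rewrite sigmaE.
apply/closed_cross_powerP => u v _ /=.
under eq_set do rewrite map_cat /=.
set B := [set z | D (fg_of_seq (map (@pos_letter X) u ++ z ::
  map (@pos_letter X) v))].
by have /closed_sigTP/(_ true) := cD _ _ : closed B.
Qed.

(** No cancellation can produce a reduced word as long as the original. *)
Lemma sigma_imageP (X : topologicalType) n (A : set (cross_power X n)) s :
  size s <= n ->
  (@sigma X n @` A) (fg_of_seq s) <->
  exists2 t, A t & s = map (@pos_letter X) (tval t).
Proof.
move=> sn; split=> [[t At /(congr1 (@fg_word X)) /= ts]|[t At ->]].
  exists t => //; rewrite ts reduced_reduce //; apply: contraLR sn.
  by move/size_reduce_lt; rewrite -ts size_map size_tuple -ltnNge.
by exists t => //; rewrite sigmaE.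
Qed.

(** For a word [u z v] of length [n], membership in the image of [A] forces [u]
    and [v] to be positive; the slice is then a copy of a slice of [A]. *)
Lemma sigma_closed (X : topologicalType) n (A : set (cross_power X n)) :
  accessible_space X -> closed A -> closed (@sigma X n @` A).
Proof.
move=> X_T1 cA.
have An : @sigma X n @` A `<=` Fq_le n.
  by move=> _ [t _ <-]; rewrite /Fq_le /= size_map size_tuple.
apply/(closed_Fq_leP X_T1 An) => u v uvn.
pose P z := exists2 t, A t & u ++ z :: v = map (@pos_letter X) (tval t).
have -> : [set z | (@sigma X n @` A) (fg_of_seq (u ++ z :: v))] = P.
  by apply/eq_set => z; apply/propext/sigma_imageP; rewrite size_cat addnS.
have [[z0 [t0 At0 uvt0]]|noz] := pselect (exists z, P z); last first.
  rewrite (_ : P = set0); first exact: closed0.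
  by apply/seteqP; split=> // z Pz; apply: noz; exists z.
(* One letter [z0] in the slice shows that [u] and [v] are positive words. *)
have pos_word s w : map (@pos_letter X) s = w ->
  map (@pos_letter X) (map (@letter_base X) w) = w.
  by move=> <-; rewrite -!map_comp.
have := uvt0; rewrite -(cat_take_drop (size u) (tval t0)) map_cat.
have un : size u <= size (tval t0).
  by rewrite -(size_map (@pos_letter X)) -uvt0 size_cat leq_addr.
move/eqP; rewrite eqseq_cat ?size_map ?size_takel // => /andP[/eqP ut /eqP].
case dt : (drop _ _) => [|x0 v0] //= [_ vt].
have {ut} uE := esym (pos_word _ _ (esym ut)).
have {vt} vE := esym (pos_word _ _ (esym vt)).
set u' := map _ u in uE; set v' := map _ v in vE.
apply/closed_sigTP => -[]; last first.
  rewrite (_ : _ @^-1` _ = set0); first exact: closed0.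
  apply/seteqP; split=> // x [t _ xt].
  have : existT (fun=> X) false x \in map (@pos_letter X) (tval t).
    by rewrite -xt mem_cat mem_head orbT.
  by case/mapP.
have := cA; rewrite (_ : A = [set t | (@tval n X @` A) (tval t)]); last first.
  by apply/seteqP; split=> [t At|t [s As /val_inj <-]] //; exists t.
move/closed_cross_powerP => /(_ u' v').
rewrite !size_map -addnS -[_ + _](size_cat u (z0 :: v)) uvt0 size_map size_tuple.
move=> /(_ erefl); congr closed; apply/seteqP; split=> x /= [t At tE].
  by exists t => //; rewrite tE map_cat /= -uE -vE.
exists t => //; apply: (inj_map (@pos_letter_inj X)).
by rewrite map_cat /= -uE -vE.
Qed.

Theorem theorem1p1 (X : topologicalType) (X_T1 : accessible_space X) :
  [/\ forall n : nat, (1 <= n)%N -> closed_embedding (@sigma X n),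
      weak_topology_wrt (@Fq_le X)
    & forall n : nat, quotient_map (@i_map X n)].
Proof.
split=> [n _||n]; last exact: i_map_quotient.
- apply: closed_injection_embedding; first exact: sigma_inj.
    exact: sigma_continuous.
  by move=> A; exact: sigma_closed.
- exact: Fq_weak_topology.
Qed.
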